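(* Let $q$ be a prime power, let $\xi\in\mathbb F_{q^2}\setminus\mathbb F_q$, let $k\ge0$ be an integer with $k\le q+1$, and let $W$ be a $\mathrm{GL}_2(\mathbb F_q)$-invariant subspace of $\mathbb F_q[X,Y]_k$. Let $m$ be a positive integer and suppose that the transformed subspace $\widetilde W\subseteq\mathbb F_{q^2}[U,V]_k$ is given by $$\widetilde W=\Big\{\sum_{a=0}^k c_aU^{k-a}V^a:\ c_a\in\mathbb F_{q^2},\ \sum_{a=0}^k\lambda_{r,a}c_a=0\ \text{for }1\le r\le m\Big\},$$ where $\lambda_{r,a}\in\mathbb F_{q^2}$. Then $$\widetilde{\mathcal B}_W=\Big\{\,T\subseteq U_{q+1}:\ |T|=k,\ \sum_{a=0}^k(-1)^a\lambda_{r,a}e_a(T)=0\ \text{for }1\le r\le m\Big\}.$$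
   Context: $\mathbb F_q[X,Y]_k$ is the $\mathbb F_q$-space of homogeneous polynomials of degree $k$ in $X,Y$ over $\mathbb F_q$ (including $0$). The group $\mathrm{GL}_2(\mathbb F_q)$ acts on it by $(g\cdot f)(X,Y)=f(dX-bY,-cX+aY)$ for $g=\begin{pmatrix}a&b\\c&d\end{pmatrix}$; an $\mathbb F_q$-subspace $W$ is $\mathrm{GL}_2(\mathbb F_q)$-invariant if $g\cdot f\in W$ for all $g\in\mathrm{GL}_2(\mathbb F_q)$, $f\in W$. $\mathbb P^1(\mathbb F_q)=\mathbb F_q\cup\{\infty\}$. For a $k$-subset $S\subseteq\mathbb P^1(\mathbb F_q)$, $F_S(X,Y)=\prod_{t\in S}(X-tY)$, where the factor for $t=\infty$ is taken to be $Y$. The block set is $\mathcal B_W=\{S\subseteq\mathbb P^1(\mathbb F_q): |S|=k,\ F_S\in W\}$. $U_{q+1}=\{u\in\mathbb F_{q^2}^\times:u^{q+1}=1\}$. The Cayley transform is the bijection $\kappa:\mathbb P^1(\mathbb F_q)\to U_{q+1}$, $\kappa(x)=\frac{x-\xi}{x-\xi^q}$ for $x\in\mathbb F_q$, $\kappa(\infty)=1$. Set $\widetilde{\mathcal B}_W=\{\kappa(S):S\in\mathcal B_W\}$. The transformed subspace is $$\widetilde W=\mathrm{span}_{\mathbb F_{q^2}}\{f(\xi^qU-\xi V,\,U-V):f\in W\}\subseteq\mathbb F_{q^2}[U,V]_k.$$ For a finite set $T=\{u_1,\dots,u_k\}$ of field elements, $e_a(T)$ is the $a$-th elementary symmetric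 polynomial evaluated at $u_1,\dots,u_k$ ($e_0=1$). *)

(* Defs.v *)
From HB Require Import structures.
From mathcomp Require Import all_boot all_order all_fingroup all_algebra.
From mathcomp Require Import all_solvable all_field.
From mathcomp Require Import mpoly.

Set Implicit Arguments.
Unset Strict Implicit.
Unset Printing Implicit Defensive.

Import GRing.Theory.

Local Open Scope ring_scope.

Lemma dhomog_XU (R : nzRingType) (n : nat) (i : 'I_n) :
  ('X_i : {mpoly R[n]}) \is 1.-homog.
Proof. by rewrite dhomogX /= mdeg1. Qed.

Lemma dhomog_comb (R : comNzRingType) (c0 c1 : R) :
  (c0 *: 'X_0 + c1 *: 'X_1 : {mpoly R[2]}) \is 1.-homog.
Proof. by apply: dhomogD; apply/dhomogZ/dhomog_XU. Qed.

Lemma dhomog_comp (R : comNzRingType) (n l d : nat) (p : {mpoly R[n]})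
    (lq : n.-tuple {mpoly R[l]}) :
  p \is d.-homog -> (forall i, tnth lq i \is 1.-homog) ->
  p \mPo lq \is d.-homog.
Proof.
move=> /dhomogP hp hq; rewrite comp_mpolyEX big_seq.
apply: rpred_sum => m /hp <-; apply: rpredZ.
rewrite comp_mpolyX /= mdegE.
elim/big_ind2: _ => [|a e b f ha hb|i _]; first exact: dhomog1.
  exact: dhomogM.
by have := dhomogMn (m i) (hq i); rewrite mul1n.
Qed.

Lemma dhomog_map (R S : nzRingType) (h : {rmorphism R -> S}) (n d : nat)
    (p : {mpoly R[n]}) : p \is d.-homog -> map_mpoly h p \is d.-homog.
Proof.
move=> /dhomogP hp; apply/dhomogP => m.
rewrite mcoeff_msupp mcoeff_map_mpoly => nz; apply: hp.
by rewrite mcoeff_msupp; apply: contraNneq nz => ->; rewrite raddf0.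
Qed.

(* The substitution X := p0 U + p1 V, Y := q0 U + q1 V in f(X, Y). *)
Definition lin_subst (R : comNzRingType) (p0 p1 q0 q1 : R) :
    2.-tuple {mpoly R[2]} :=
  [tuple p0 *: 'X_0 + p1 *: 'X_1; q0 *: 'X_0 + q1 *: 'X_1].

Lemma dhomog_lin_subst (R : comNzRingType) (p0 p1 q0 q1 : R) (d : nat)
    (p : {mpoly R[2]}) :
  p \is d.-homog -> p \mPo lin_subst p0 p1 q0 q1 \is d.-homog.
Proof.
move=> hp; apply: dhomog_comp => // i.
by case: i => [[|[|i]] hi] //; rewrite (tnth_nth 0) /=; apply: dhomog_comb.
Qed.

Definition gl2_act (R : comUnitRingType) (k : nat) (g : 'M[R]_2)
    (f : dhomog 2 R k) : dhomog 2 R k :=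
  DHomog (dhomog_lin_subst (g 1 1) (- g 0 1) (- g 1 0) (g 0 0)
            (dhomog_is_dhomog f)).

Definition gl2_invariant (F : finFieldType) (k : nat)
    (W : {vspace dhomog 2 F k}) : Prop :=
  forall (g : {'GL_2[F]}) (f : dhomog 2 F k),
    f \in W -> gl2_act (GLval g) f \in W.

(* The projective line over F is option F, with None the point at infinity. *)
Definition block_poly (F : finFieldType) (S : {set option F}) : {mpoly F[2]} :=
  \prod_(t in S) (if t is Some x then 'X_0 - x *: 'X_1 else 'X_1).

(* p \in W for a polynomial p not known beforehand to be homogeneous of
   degree k: insub p is None when it is not. *)
Definition mem_hspace (F : fieldType) (k : nat) (W : {vspace dhomog 2 F k})
    (p : {mpoly F[2]}) : bool :=
  if insub p is Some f then f \in W else false.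

Definition blocks (F : finFieldType) (k : nat) (W : {vspace dhomog 2 F k}) :
    {set {set option F}} :=
  [set S : {set option F} | (#|S| == k) && mem_hspace W (block_poly S)].

Definition unit_circle (L : finFieldType) (q : nat) : {set L} :=
  [set u : L | (u != 0) && (u ^+ q.+1 == 1)].

Section Cayley.

Variables (F L : finFieldType) (iota : {rmorphism F -> L}) (xi : L).

Definition cayley (t : option F) : L :=
  if t is Some x then (iota x - xi) / (iota x - xi ^+ #|F|) else 1.

Definition cayley_blocks (k : nat) (W : {vspace dhomog 2 F k}) :
    {set {set L}} :=
  [set cayley @: S | S : {set option F} in blocks W].

Definition cayley_subst (k : nat) (f : dhomog 2 F k) : dhomog 2 L k :=
  DHomog (dhomog_lin_subst (xi ^+ #|F|) (- xi) 1 (- 1)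
            (dhomog_map iota (dhomog_is_dhomog f))).

(* finvect_type makes the finite space of forms over F enumerable, so that
   the sequence below runs over all f in W. *)
Definition cayley_space (k : nat) (W : {vspace dhomog 2 F k}) :
    {vspace dhomog 2 L k} :=
  <<[seq cayley_subst f | f : finvect_type (dhomog 2 F k) in W]>>%VS.

End Cayley.

Definition elem_sym (L : finFieldType) (a : nat) (T : {set L}) : L :=
  (mesym #|T| L a).@[enum_val].

(* Main.v *)
(* The substitution X := xi^q U - xi V, Y := U - V sends X - t Y to a nonzero
   multiple of U - kappa(t) V, so F_S goes to a nonzero multiple of
   \prod_(u in kappa(S)) (U - u V), whose coefficients are the (-1)^a e_a; the
   linear conditions cutting out the transformed subspace thus become those on
   the e_a.  No form over F outside W enters that subspace after extending the
   scalars to L: as (1, xi) is an F-basis of L, each element of the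
   L-span is psi(w1) + xi psi(w2) with w1, w2 in W, and psi is injective. *)

Require Import Defs.
From HB Require Import structures.
From mathcomp Require Import all_boot all_order all_fingroup all_algebra.
From mathcomp Require Import all_solvable all_field.
From mathcomp Require Import mpoly.
From mathcomp Require Import ring.

Set Implicit Arguments.
Unset Strict Implicit.
Unset Printing Implicit Defensive.

Import GRing.Theory.

Local Open Scope ring_scope.

(** * Composition of linear substitutions on forms *)

Section LinearSubstitution.

Variable R : comNzRingType.

Lemma comp_mpolyA (n k l : nat) (p : {mpoly R[n]})
    (s : n.-tuple {mpoly R[k]}) (t : k.-tuple {mpoly R[l]}) :
  (p \mPo s) \mPo t = p \mPo [tuple tnth s i \mPo t | i < n].
Proof.
rewrite [p \mPo s]comp_mpolyEX [RHS]comp_mpolyEX raddf_sum /=.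
apply: eq_bigr => m _.
rewrite comp_mpolyZ !comp_mpolyX rmorph_prod; congr (_ *: _).
by apply: eq_bigr => i _; rewrite rmorphXn tnth_mktuple.
Qed.

(** Each monomial of degree k picks up one factor c per variable. Applied to a matrix composed with
    its adjugate, where c is the determinant, this makes the substitution invertible on forms. *)
Lemma comp_mpoly_scaled_id (n k : nat) (p : {mpoly R[n]})
    (s : n.-tuple {mpoly R[n]}) (c : R) :
  p \is k.-homog -> (forall i, tnth s i = c *: 'X_i) -> p \mPo s = c ^+ k *: p.
Proof.
move=> /dhomogP hp hs; rewrite comp_mpolyEX {3}(mpolyE p) raddf_sum /=.
apply: eq_big_seq => m /hp /= mk; rewrite comp_mpolyX scalerA mulrC -scalerA.
congr (_ *: _); rewrite -mk mdegE -prodrXr mpolyXE_id -scaler_prod.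
by apply: eq_bigr => i _; rewrite hs exprZn.
Qed.

End LinearSubstitution.

(** * Products of linear forms and their coefficients *)

Lemma prod_sub_scale_mesym (R : comNzRingType) (A : comAlgType R) (n : nat)
    (c : 'I_n -> R) (x y : A) :
  \prod_i (x - c i *: y) =
  \sum_(a < n.+1) ((-1) ^+ a * (mesym n R a).@[c]) *: (x ^+ (n - a) * y ^+ a).
Proof.
have leJ (J : {set 'I_n}) : (#|J| < n.+1)%N.
  by rewrite ltnS -[leqRHS]card_ord max_card.
(* With the [y] term first, the set [J] in the distributed product collects the factors that
   contribute [y]; grouping by [a = #|J|] then produces the a-th elementary symmetric polynomial. *)
under eq_bigr do rewrite addrC.
rewrite bigA_distr.
rewrite (partition_big (fun J : {set 'I_n} => Ordinal (leJ J)) predT) //=.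
apply: eq_bigr => a _; rewrite /mesym raddf_sum mulr_sumr scaler_suml.
apply: eq_bigr => J /eqP/(congr1 val)/= Ja.
rewrite (bigID (mem J)) /=.
rewrite (eq_bigr (fun i => (- c i) *: y)); last by move=> i ->; rewrite scaleNr.
rewrite [X in _ * X](eq_bigr (fun=> x)); last by move=> i /negPf->.
rewrite scaler_prod !prodr_const.
have -> : #|(fun i => i \notin J)| = (n - a)%N.
  by apply: (@addnI a); rewrite -{1}Ja cardC card_ord subnKC // -ltnS.
rewrite prodrN Ja rmorph_prod /= -scalerAl [y ^+ a * _]mulrC; congr (_ * _ *: _).
by apply: eq_bigr => i _; rewrite mevalXU.
Qed.

Lemma prod_sub_scale_elem_sym (L : finFieldType) (A : comAlgType L)
    (T : {set L}) (k : nat) (x y : A) :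
  #|T| = k ->
  \prod_(u in T) (x - u *: y) =
  \sum_(a < k.+1) ((-1) ^+ a * elem_sym a T) *: (x ^+ (k - a) * y ^+ a).
Proof. by move=> <-; rewrite big_enum_val; apply: prod_sub_scale_mesym. Qed.

Lemma block_poly_dhomog (F : finFieldType) (S : {set option F}) :
  block_poly S \is #|S|.-homog.
Proof.
rewrite /block_poly -sum1_card.
elim/big_ind2: _ => [|a p b r ha hr|t _]; first exact: dhomog1.
  exact: dhomogM.
case: t => [x|]; last exact: dhomog_XU.
by rewrite -scaleNr -[X in X + _]scale1r dhomog_comb.
Qed.

Lemma mem_hspaceE (F : fieldType) (k : nat) (W : {vspace dhomog 2 F k})
    (f : dhomog 2 F k) : mem_hspace W f = (f \in W).
Proof. by rewrite /mem_hspace valK. Qed.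

(** The description of the transformed subspace only provides some coefficient vector; this
    identifies it with the one computed from the block polynomial. *)
Lemma sum_monomials_inj (R : nzRingType) (k : nat) (c d : 'I_k.+1 -> R) :
  \sum_(a < k.+1) c a *: ('X_0 ^+ (k - a) * 'X_1 ^+ a) =
    \sum_(a < k.+1) d a *: ('X_0 ^+ (k - a) * 'X_1 ^+ a) :> {mpoly R[2]} ->
  c =1 d.
Proof.
have coefE (e : 'I_k.+1 -> R) (b : 'I_k.+1) :
    (\sum_(a < k.+1) e a *: ('X_0 ^+ (k - a) * 'X_1 ^+ a) : {mpoly R[2]})
      @_(U_(0) *+ (k - b) + U_(1) *+ b) = e b.
  rewrite raddf_sum (bigD1 b) //= big1 ?addr0 => [|a ab].
    by rewrite mcoeffZ !mpolyXn -mpolyXD mcoeffX eqxx mulr1.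
  (* The exponent of the second variable alone already determines the monomial. *)
  rewrite mcoeffZ !mpolyXn -mpolyXD mcoeffX; case: eqP => [/mnmP/(_ 1)|].
    rewrite !mnmDE !mulmnE !mnm1E !mul0n !mul1n !add0n => /val_inj e'.
    by rewrite e' eqxx in ab.
  by rewrite mulr0.
by move=> e b; rewrite -[LHS]coefE e coefE.
Qed.

(** * The q-power map, the basis (1, xi) and the Cayley transform *)

Lemma pnat_card_finField (F : finFieldType) p :
  p \in [pchar F] -> p.-nat #|F|.
Proof.
move=> pF; have := abelem_pgroup (fin_ring_pchar_abelem pF).
by rewrite /pgroup cardsT.
Qed.

Section QuadraticExtension.

Variables (F L : finFieldType) (iota : {rmorphism F -> L}).

Local Notation q := #|F|.

(** Through [iota], L has the characteristic of F, and q is a power of it, so raising to the q is an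
    iterated Frobenius. *)
Lemma exprB_card (x y : L) : (x - y) ^+ q = x ^+ q - y ^+ q.
Proof.
have [p _ pF] := finPcharP F.
have qL : [pchar L].-nat q.
  by rewrite (eq_pnat _ (pcharf_eq (rmorph_pchar iota pF))) pnat_card_finField.
by rewrite exprDn_pchar // exprNn_pchar.
Qed.

Lemma expr_card_rmorph x : iota x ^+ q = iota x.
Proof. by rewrite -rmorphXn expf_card. Qed.

(** X^q - X splits as the product of the X - x over x in F, so one of these factors vanishes at
    z. *)
Lemma fixed_expr_card (z : L) : z ^+ q = z -> exists x, z = iota x.
Proof.
move=> zq; have /(congr1 (map_poly iota)) := finField_genPoly F.
rewrite rmorphB rmorph_prod /= map_polyXn map_polyX.
move=> /(congr1 (fun p => p.[z])); rewrite horner_prod !hornerE zq subrr.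
move=> /esym/eqP/prodf_eq0[x _]; rewrite rmorphB /= map_polyX map_polyC !hornerE.
by rewrite subr_eq0 => /eqP; exists x.
Qed.

Variable xi : L.
Hypothesis cardL : #|L| = (q ^ 2)%N.
Hypothesis xiF : forall x, xi <> iota x.

Lemma conj_neq : xi ^+ q != xi.
Proof. by apply/eqP => /fixed_expr_card[x]; apply: xiF. Qed.

Lemma conj_sub_neq0 x : iota x - xi ^+ q != 0.
Proof.
rewrite -[iota x]expr_card_rmorph -exprB_card expf_eq0 negb_and subr_eq0.
by apply/orP; right; apply/eqP => /esym; apply: xiF.
Qed.

Lemma xi_independent a b c : iota a = iota b + xi * iota c -> a = b.
Proof.
move=> e; have [c0|nz] := eqVneq c 0.
  by move: e; rewrite c0 rmorph0 mulr0 addr0 => /fmorph_inj.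
case: (@xiF ((a - b) / c)).
by rewrite fmorph_div rmorphB e addrC addKr mulfK // fmorph_eq0.
Qed.

(** Independence of 1 and xi makes (a, b) -> a + xi b injective, and both sides have q^2
    elements. *)
Lemma quadratic_decomposition (z : L) : exists a b, z = iota a + xi * iota b.
Proof.
pose f (ab : F * F) := iota ab.1 + xi * iota ab.2.
have f_inj : injective f.
  move=> [a b] [c d]; rewrite /f /= => e.
  have ac : a = c.
    apply: (@xi_independent _ _ (d - b)).
    by rewrite rmorphB mulrBr addrA -e addrK.
  have xi0 : xi != 0 by apply/eqP; rewrite -(rmorph0 iota); apply: xiF.
  by move: e; rewrite ac => /addrI/(mulfI xi0)/fmorph_inj->.
have /(_ z)/codomP[[a b] ->] : forall z, z \in codom f.
  by apply: inj_card_onto => //; rewrite card_prod cardL mulnn.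
by exists a, b.
Qed.

Lemma cayley_inj : injective (cayley iota xi).
Proof.
(* The value 1 is reserved for infinity: a finite x reaching it would force xi = xi^q. *)
have ne1 x : cayley iota xi (Some x) <> 1.
  move=> /(canRL (divfK (conj_sub_neq0 x))); rewrite mul1r => /addrI/oppr_inj.
  by move/eqP; rewrite eq_sym (negPf conj_neq).
case=> [x|] [y|] // e; last 2 first; [by case: (ne1 x)|by case: (ne1 y)|].
congr Some; apply: (fmorph_inj iota).
move/eqP: e; rewrite /= eqr_div ?conj_sub_neq0 // -subr_eq0.
have -> : (iota x - xi) * (iota y - xi ^+ q) - (iota y - xi) * (iota x - xi ^+ q)
  = (iota x - iota y) * (xi - xi ^+ q) by ring.
by rewrite mulf_eq0 !subr_eq0 [xi == _]eq_sym (negPf conj_neq) orbF => /eqP.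
Qed.

Lemma card_unit_circle : (#|unit_circle L q| <= q.+1)%N.
Proof.
rewrite cardE; apply: max_unity_roots => //; last exact: enum_uniq.
by apply/allP => u; rewrite mem_enum inE => /andP[_]; rewrite unity_rootE.
Qed.

Lemma cayley_unit_circle t : cayley iota xi t \in unit_circle L q.
Proof.
case: t => [x|]; rewrite inE ?oner_eq0 ?expr1n //=.
have nz := conj_sub_neq0 x.
have nz' : iota x - xi != 0 by rewrite subr_eq0; apply/eqP => /esym; apply: xiF.
(* Since xi^(q^2) = xi, the q-th power exchanges numerator and denominator, so u * u^q = 1. *)
rewrite mulf_neq0 ?invr_eq0 //= exprS expr_div_n !exprB_card.
by rewrite expr_card_rmorph -exprM mulnn -cardL expf_card mulrACA -invfM mulrC
  [_ * (_ - xi)]mulrC mulVf // mulf_neq0.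
Qed.

(** By counting: the image lies in the circle and has q + 1 elements by injectivity, while the
    circle has at most q + 1. *)
Lemma cayley_imset : cayley iota xi @: setT = unit_circle L q.
Proof.
apply/eqP; rewrite eqEcard; apply/andP; split.
  by apply/subsetP => _ /imsetP[t _ ->]; apply: cayley_unit_circle.
by rewrite (card_imset _ cayley_inj) cardsT card_option card_unit_circle.
Qed.

End QuadraticExtension.

(** * The Cayley substitution on forms and the space it spans *)

Section CayleySubstitution.

Variables (F L : finFieldType) (iota : {rmorphism F -> L}) (xi : L).

Local Notation q := #|F|.

(** The map underlying [cayley_subst], freed from a fixed degree so that it applies to each linear
    factor of a block polynomial. *)
Definition cayley_map (p : {mpoly F[2]}) : {mpoly L[2]} :=
  map_mpoly iota p \mPo lin_subst (xi ^+ q) (- xi) 1 (- 1).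

Lemma cayley_mapD p r : cayley_map (p + r) = cayley_map p + cayley_map r.
Proof. by rewrite /cayley_map !raddfD. Qed.

Lemma cayley_mapZ x p : cayley_map (x *: p) = iota x *: cayley_map p.
Proof. by rewrite /cayley_map map_mpolyZ comp_mpolyZ. Qed.

Lemma cayley_map_prod (I : finType) (P : pred I) (f : I -> {mpoly F[2]}) :
  cayley_map (\prod_(i | P i) f i) = \prod_(i | P i) cayley_map (f i).
Proof. by rewrite /cayley_map !rmorph_prod. Qed.

Lemma cayley_mapX0 : cayley_map 'X_0 = xi ^+ q *: 'X_0 - xi *: 'X_1.
Proof. by rewrite /cayley_map map_mpolyX comp_mpolyXU /= scaleNr. Qed.

Lemma cayley_mapX1 : cayley_map 'X_1 = 'X_0 - 'X_1.
Proof. by rewrite /cayley_map map_mpolyX comp_mpolyXU /= scale1r scaleN1r. Qed.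

Hypothesis cardL : #|L| = (q ^ 2)%N.
Hypothesis xiF : forall x, xi <> iota x.

Lemma cayley_map_block_poly (S : {set option F}) :
  exists2 C : L, C != 0 &
    cayley_map (block_poly S) =
      C *: \prod_(u in cayley iota xi @: S) ('X_0 - u *: 'X_1).
Proof.
(* [w t] is the coefficient of U in the image of the factor at t. *)
pose w (t : option F) := if t is Some x then xi ^+ q - iota x else 1.
exists (\prod_(t in S) w t).
  apply/prodf_neq0 => -[x|] _; last exact: oner_neq0.
  by rewrite /= -opprB oppr_eq0 conj_sub_neq0.
rewrite big_imset /=; last by move=> s t _ _; apply: cayley_inj.
rewrite -scaler_prod cayley_map_prod; apply: eq_bigr => -[x|] _ /=; last first.
  by rewrite cayley_mapX1 !scale1r.
rewrite -scaleNr cayley_mapD cayley_mapZ cayley_mapX0 cayley_mapX1.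
have nz : iota x - xi ^+ q != 0 by apply: conj_sub_neq0.
rewrite rmorphN scaleNr !scalerBr scalerA scalerBl.
have -> : (xi ^+ q - iota x) * ((iota x - xi) / (iota x - xi ^+ q)) = xi - iota x.
  by rewrite -[xi ^+ q - _]opprB mulNr mulrC divfK // opprB.
by rewrite scalerBl !opprD addrACA.
Qed.

Lemma cayley_map_dhomog_inj (k : nat) (p r : {mpoly L[2]}) :
  p \is k.-homog -> r \is k.-homog ->
  p \mPo lin_subst (xi ^+ q) (- xi) 1 (- 1) =
    r \mPo lin_subst (xi ^+ q) (- xi) 1 (- 1) -> p = r.
Proof.
pose s := lin_subst (xi ^+ q) (- xi) 1 (- 1).
(* The adjugate of the matrix of [s], whose determinant is xi - xi^q. *)
pose t := lin_subst (- 1) xi (- 1) (xi ^+ q).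
have nz : xi - xi ^+ q != 0 by rewrite subr_eq0 eq_sym (conj_neq xiF).
have st (p' : {mpoly L[2]}) : p' \is k.-homog ->
    (p' \mPo s) \mPo t = (xi - xi ^+ q) ^+ k *: p'.
  move=> hp; rewrite comp_mpolyA; apply: comp_mpoly_scaled_id => // i.
  rewrite tnth_mktuple (tnth_nth 0) /=.
  case: i => [[|[|//]] hi] /=; rewrite comp_mpolyD !comp_mpolyZ !comp_mpolyXU /=.
    rewrite (_ : Ordinal hi = 0); last exact: val_inj.
    rewrite !scalerDr !scalerA addrACA -!scalerDl.
    by rewrite !mulrN1 !mulNr opprK [xi * _]mulrC subrr scale0r addr0 addrC.
  rewrite (_ : Ordinal hi = 1); last exact: val_inj.
  rewrite !scalerDr !scalerA addrACA -!scalerDl.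
  by rewrite !mulN1r !mul1r opprK addNr scale0r add0r.
move=> hp hr /(congr1 (comp_mpoly t)).
by rewrite (st p hp) (st r hr) => /(scalerI (expf_neq0 k nz)).
Qed.

Lemma cayley_space_decomposition (k : nat) (W : {vspace dhomog 2 F k})
    (g : dhomog 2 L k) :
  g \in cayley_space iota xi W ->
  exists w1 w2 : dhomog 2 F k, [/\ w1 \in W, w2 \in W &
    g = cayley_subst iota xi w1 + xi *: cayley_subst iota xi w2].
Proof.
have substD (u v : dhomog 2 F k) : cayley_subst iota xi (u + v) =
    cayley_subst iota xi u + cayley_subst iota xi v.
  by apply: val_inj; rewrite /= -cayley_mapD.
have substZ x (u : dhomog 2 F k) :
    cayley_subst iota xi (x *: u) = iota x *: cayley_subst iota xi u.
  by apply: val_inj; rewrite /= -cayley_mapZ.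
(* Expand g over the generators: the required shape is stable under sums, so it is enough to treat
   one generator times a scalar z of L. *)
move=> /(@coord_span _ _ _ (in_tuple _))->.
elim/big_ind: _ => [|_ _ [u1 [u2 [u1W u2W ->]]] [v1 [v2 [v1W v2W ->]]]|i _].
- exists 0, 0; rewrite !mem0v; split=> //.
  by have := substZ 0 0; rewrite rmorph0 !scale0r => ->; rewrite scaler0 addr0.
- exists (u1 + v1), (u2 + v2); rewrite !memvD //; split=> //.
  by rewrite !substD scalerDr addrACA.
move: (coord _ i g) => z; have /imageP[w wW ->] := mem_nth 0 (ltn_ord i).
have [a [b ->]] := quadratic_decomposition cardL xiF z.
exists (a *: w), (b *: w); rewrite !memvZ //; split=> //.
by rewrite !substZ scalerA scalerDl.
Qed.

Lemma mem_cayley_space (k : nat) (W : {vspace dhomog 2 F k}) (f : dhomog 2 F k) :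
  (cayley_subst iota xi f \in cayley_space iota xi W) = (f \in W).
Proof.
apply/idP/idP => [|fW]; last first.
  by apply/memv_span/imageP; exists f.
case/cayley_space_decomposition => w1 [w2 [w1W _ /(congr1 val)/= e]].
suff -> : f = w1 by [].
(* Once the substitution is cancelled, comparing coefficients and using independence of 1 and xi
   leaves f = w1. *)
have : map_mpoly iota f = map_mpoly iota w1 + xi *: map_mpoly iota w2.
  apply: (@cayley_map_dhomog_inj k); rewrite ?comp_mpolyD ?comp_mpolyZ //.
    exact/dhomog_map/dhomog_is_dhomog.
  apply: dhomogD; last apply: dhomogZ; exact/dhomog_map/dhomog_is_dhomog.
move=> /mpolyP eq_coef; apply: val_inj; apply/mpolyP => m.
have := eq_coef m; rewrite mcoeffD mcoeffZ !mcoeff_map_mpoly.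
exact: xi_independent.
Qed.

End CayleySubstitution.

(** * Linear conditions on the elementary symmetric values of a block *)

Theorem proposition6 (F L : finFieldType) (iota : {rmorphism F -> L}) (xi : L)
    (k : nat) (W : {vspace dhomog 2 F k}) (m : nat)
    (lambda : 'I_m -> 'I_k.+1 -> L) :
  #|L| = (#|F| ^ 2)%N ->
  (forall x : F, xi <> iota x) ->
  (k <= #|F|.+1)%N ->
  gl2_invariant W ->
  (0 < m)%N ->
  (forall g : dhomog 2 L k,
     g \in cayley_space iota xi W <->
     exists c : 'I_k.+1 -> L,
       (forall r : 'I_m, \sum_(a < k.+1) lambda r a * c a = 0) /\
       (g : {mpoly L[2]}) =
         \sum_(a < k.+1) c a *: ('X_0 ^+ (k - a) * 'X_1 ^+ a)) ->
  cayley_blocks iota xi W =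
    [set T : {set L} |
       [&& T \subset unit_circle L #|F|, #|T| == k &
           [forall r : 'I_m,
              \sum_(a < k.+1) (-1) ^+ a * lambda r a * elem_sym a T == 0]]].
Proof.
move=> cardL xiF _ _ _ WP.
(* The criterion is first proved for S on the projective line, through its image under the Cayley
   transform. *)
have blocksP (S : {set option F}) : (S \in blocks W) =
    (#|cayley iota xi @: S| == k) &&
    [forall r : 'I_m, \sum_(a < k.+1)
      (-1) ^+ a * lambda r a * elem_sym a (cayley iota xi @: S) == 0].
  have [C C0] := cayley_map_block_poly xiF S.
  rewrite inE card_imset; last exact: cayley_inj.
  case: eqP => //= Sk; have hS := block_poly_dhomog S; rewrite Sk in hS.
  have -> : block_poly S = DHomog hS by [].
  rewrite mem_hspaceE -(mem_cayley_space cardL xiF).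
  set T := cayley iota xi @: S => mapS.
  have Tk : #|T| = k by rewrite card_imset //; apply: cayley_inj.
  have {}mapS : (cayley_subst iota xi (DHomog hS) : {mpoly L[2]}) =
      \sum_(a < k.+1) (C * ((-1) ^+ a * elem_sym a T)) *:
        ('X_0 ^+ (k - a) * 'X_1 ^+ a).
    rewrite /= -/(cayley_map iota xi _) mapS (prod_sub_scale_elem_sym _ _ Tk).
    by rewrite scaler_sumr; apply: eq_bigr => a _; rewrite scalerA.
  (* The nonzero factor C comes out of every condition and can be cancelled. *)
  have sumC r : \sum_(a < k.+1) lambda r a * (C * ((-1) ^+ a * elem_sym a T)) =
      C * \sum_(a < k.+1) (-1) ^+ a * lambda r a * elem_sym a T.
    by rewrite mulr_sumr; apply: eq_bigr => a _; ring.
  apply/idP/forallP => [/WP[c [c0 gE]] r|sum0].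
    move: gE; rewrite mapS => /sum_monomials_inj cE.
    apply/eqP/(mulfI C0); rewrite -sumC mulr0 -[RHS](c0 r).
    by apply: eq_bigr => a _; rewrite -cE.
  apply/WP; exists (fun a => C * ((-1) ^+ a * elem_sym a T)); split=> // r.
  by rewrite sumC (eqP (sum0 r)) mulr0.
apply/setP => T; rewrite inE; apply/imsetP/and3P => [[S + ->]|[TU Tk sum0]].
  rewrite blocksP => /andP[-> ->]; split=> //.
  by apply/subsetP => _ /imsetP[t _ ->]; apply: cayley_unit_circle.
(* Surjectivity onto the circle makes T the image of its preimage, which is the block sought. *)
have TE : T = cayley iota xi @: (cayley iota xi @^-1: T).
  apply/setP => u; apply/idP/imsetP => [uT|[t + ->]]; last by rewrite inE.
  have := subsetP TU u uT; rewrite -(cayley_imset cardL xiF).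
  by case/imsetP=> t _ ut; exists t => //; rewrite inE -ut.
by exists (cayley iota xi @^-1: T); rewrite // blocksP -TE Tk.
Qed.
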